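(* There exists a function $g:\bigcup_{A,B}\mathfrak{D}(AB)\to\mathbb{R}$ (value at $\rho_{AB}$ written $g(A|B)_\rho$), not equal to the zero function, such that: 1. (Monotonicity) for all states $\rho_{AB}$ and $\sigma_{A'B'}$, $\rho_{AB}\succ_A\sigma_{A'B'}$ implies $g(A|B)_\rho\le g(A'|B')_\sigma$; 2. (Weak additivity) $g(A^n|B^n)_{\rho^{\otimes n}}=n\,g(A|B)_\rho$ for every state $\rho_{AB}$ and every $n\in\mathbb{N}$; 3. (Non-negativity) $g(A|B)_\rho\ge0$ for every state $\rho_{AB}$.
   Context: All systems (Hilbert spaces) $A,B,\dots$ are finite-dimensional; $|A|$ is the dimension of $A$, $\mathfrak{D}(AB)$ the set of density operators on $A\otimes B$, $\mathbf{u}_A=I_A/|A|$ the uniform state. A quantum channel is a completely positive trace-preserving linear map; an isometric channel is one of the form $(\cdot)\mapsto U(\cdot)U^\dagger$ with $U^\dagger U=I$. Maps act as the identity on systems not mentioned. $\rho^{\otimes n}_{AB}$ is regarded as a bipartite state of $A^n=A^{\otimes n}$ and $B^n=B^{\otimes n}$. Conditionally unital channel: $\mathcal{N}_{AB\to AB'}$ such that for every $\rho_B\in\mathfrak{D}(B)$ there is $\sigma_{B'}\in\mathfrak{D}(B')$ with $\mathcal{N}(\mathbf{u}_A\otimes\rho_B)=\mathbf{u}_A\otimes\sigma_{B'}$. $A\not\to B'$ semi-causal channel: $\mathcal{N}_{AB\to AB'}$ such that $\operatorname{Tr}_A\circ\mathcal{N}\circ\mathcal{M}_A=\operatorname{Tr}_A\circ\mathcal{N}$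 for every channel $\mathcal{M}_A$ from $A$ to $A$. Conditionally mixing channel: a channel $\mathcal{N}_{AB\to AB'}$ that is both conditionally unital and $A\not\to B'$ semi-causal. Conditional majorization: $\rho_{AB}\succ_A\sigma_{A'B'}$ if there exist a system $A''$ with $|A''|\ge\max\{|A|,|A'|\}$, isometric channels $\mathcal{V}_{A\to A''}$, $\mathcal{U}_{A'\to A''}$, and a conditionally mixing channel $\mathcal{N}_{A''B\to A''B'}$ with $\mathcal{U}_{A'\to A''}(\sigma_{A'B'})=(\mathcal{N}_{A''B\to A''B'}\circ\mathcal{V}_{A\to A''})(\rho_{AB})$. *)

(* Defs.v *)
(* A system of dimension d is the Hilbert space C^d, and operators on it are
   'M[C]_d.  The composite of systems of dimensions a and b is C^(a * b), with
   basis vector i (x) j at index mxtens_index (i, j), so that the tensor product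
   of operators is the Kronecker product *t. *)
From HB Require Import structures.
From mathcomp Require Import all_boot all_order all_algebra.
From mathcomp Require Export reals.
From mathcomp Require Export complex mxtens.

Set Implicit Arguments.
Unset Strict Implicit.
Unset Printing Implicit Defensive.

Import Order.TTheory GRing.Theory Num.Theory.
Local Open Scope ring_scope.
Local Open Scope sesquilinear_scope.

Section States.
Variable C : numClosedFieldType.

Definition psdmx n (X : 'M[C]_n) : Prop :=
  X \is hermsymmx /\ forall v : 'cV[C]_n, 0 <= (v^t* *m X *m v) 0 0.

Record density (n : nat) : Type := Density {
  density_mx :> 'M[C]_n;
  density_psd : psdmx density_mx;
  density_tr : \tr density_mx = 1 }.

Definition uniform_mx n : 'M[C]_n := (n%:R^-1)%:M.

(* The partial trace over the left factor. *)
Definition ptrace_l a b (X : 'M[C]_(a * b)) : 'M[C]_b :=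
  \matrix_(j, l) \sum_(i < a) X (mxtens_index (i, j)) (mxtens_index (i, l)).

(* F (x) id_k: for basis indices p and q of the right factor, F acts on the
   block (I (x) <p|) X (I (x) |q>). *)
Definition tens_id k m n (F : 'M[C]_m -> 'M[C]_n) (X : 'M[C]_(m * k)) :
    'M[C]_(n * k) :=
  \matrix_(p, q)
    F (\matrix_(i, j) X (mxtens_index (i, (mxtens_unindex p).2))
                        (mxtens_index (j, (mxtens_unindex q).2)))
      (mxtens_unindex p).1 (mxtens_unindex q).1.

Lemma tens_id_tens k m n (F : {linear 'M[C]_m -> 'M[C]_n})
    (X : 'M[C]_m) (Y : 'M[C]_k) :
  tens_id F (X *t Y) = F X *t Y.
Proof.
apply/matrixP => p q; case: (mxtens_indexP p) => i j.
case: (mxtens_indexP q) => k' l.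
rewrite tensmxE mxE !mxtens_indexK /=.
have -> : (\matrix_(i0, j0) (X *t Y) (mxtens_index (i0, j))
             (mxtens_index (j0, l)) : 'M[C]_m) = Y j l *: X.
  by apply/matrixP => s t; rewrite mxE tensmxE mxE mulrC.
by rewrite linearZ mxE mulrC.
Qed.

End States.

Section Channels.
Variable C : numClosedFieldType.

Definition trace_preserving m n (F : {linear 'M[C]_m -> 'M[C]_n}) : Prop :=
  forall X, \tr (F X) = \tr X.

Definition completely_positive m n (F : {linear 'M[C]_m -> 'M[C]_n}) : Prop :=
  forall k (X : 'M[C]_(m * k)), psdmx X -> psdmx (tens_id F X).

Definition channel m n (F : {linear 'M[C]_m -> 'M[C]_n}) : Prop :=
  completely_positive F /\ trace_preserving F.

Definition isometric_channel m n (F : {linear 'M[C]_m -> 'M[C]_n}) : Prop :=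
  exists V : 'M[C]_(n, m),
    V^t* *m V = 1%:M /\ forall X, F X = V *m X *m V^t*.

Definition conditionally_unital a b b'
    (N : {linear 'M[C]_(a * b) -> 'M[C]_(a * b')}) : Prop :=
  forall rho : density C b, exists sigma : density C b',
    N (uniform_mx C a *t rho) = uniform_mx C a *t sigma.

Definition semi_causal a b b'
    (N : {linear 'M[C]_(a * b) -> 'M[C]_(a * b')}) : Prop :=
  forall M : {linear 'M[C]_a -> 'M[C]_a}, channel M ->
  forall X : 'M[C]_(a * b), ptrace_l (N (tens_id M X)) = ptrace_l (N X).

Definition conditionally_mixing a b b'
    (N : {linear 'M[C]_(a * b) -> 'M[C]_(a * b')}) : Prop :=
  [/\ channel N, conditionally_unital N & semi_causal N].

Definition cond_majorizes a b a' b'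
    (rho : density C (a * b)) (sigma : density C (a' * b')) : Prop :=
  exists (a'' : nat)
         (V : {linear 'M[C]_a -> 'M[C]_a''})
         (U : {linear 'M[C]_a' -> 'M[C]_a''})
         (N : {linear 'M[C]_(a'' * b) -> 'M[C]_(a'' * b')}),
    [/\ (maxn a a' <= a'')%N,
        isometric_channel V,
        isometric_channel U,
        conditionally_mixing N
      & tens_id U sigma = N (tens_id V rho)].

End Channels.

Arguments cond_majorizes {C} a b a' b' rho sigma.

Section TensorPowers.
Variable C : numClosedFieldType.

(* The canonical isomorphism A^n (x) B^n ~ (A (x) B)^n on basis indices, sending
   ((x_1, .., x_n), (y_1, .., y_n)) to ((x_1, y_1), .., (x_n, y_n)).  The case
   split at n = 1 follows ntensmx, for which a ^ 1 is a itself. *)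
Fixpoint zip_index_rec a b n :
    'I_(a ^ n.+1 * b ^ n.+1) -> 'I_((a * b) ^ n.+1) :=
  if n is n'.+1 return 'I_(a ^ n.+1 * b ^ n.+1) -> 'I_((a * b) ^ n.+1) then
    fun p =>
      let x := @mxtens_unindex a (a ^ n'.+1) (mxtens_unindex p).1 in
      let y := @mxtens_unindex b (b ^ n'.+1) (mxtens_unindex p).2 in
      @mxtens_index (a * b) ((a * b) ^ n'.+1)
        (mxtens_index (x.1, y.1),
         @zip_index_rec a b n' (mxtens_index (x.2, y.2)))
  else id.

Definition zip_index a b n : 'I_(a ^ n * b ^ n) -> 'I_((a * b) ^ n) :=
  if n is n'.+1 return 'I_(a ^ n * b ^ n) -> 'I_((a * b) ^ n)
  then @zip_index_rec a b n' else id.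

(* X^(x)n for X on A (x) B, as an operator on A^n (x) B^n. *)
Definition bipartite_power a b n (X : 'M[C]_(a * b)) : 'M[C]_(a ^ n * b ^ n) :=
  mxsub (@zip_index a b n) (@zip_index a b n) (ntensmx X n).

Lemma zip_index_inj a b n : injective (@zip_index a b n).
Proof.
case: n => [|n] //=; elim: n => [|n IHn] //= p q.
move=> /(can_inj (@mxtens_indexK _ _)) e.
have /(can_inj (@mxtens_indexK _ _)) e1 := congr1 fst e.
have /IHn /(can_inj (@mxtens_indexK _ _)) e2 := congr1 snd e.
apply: (can_inj (@mxtens_unindexK _ _)).
apply: injective_projections.
  apply: (can_inj (@mxtens_unindexK a (a ^ n.+1))).
  by apply: injective_projections; [have := congr1 fst e1 | have := congr1 fst e2].
apply: (can_inj (@mxtens_unindexK b (b ^ n.+1))).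
by apply: injective_projections; [have := congr1 snd e1 | have := congr1 snd e2].
Qed.

Lemma zip_index_bij a b n : bijective (@zip_index a b n).
Proof.
by apply: inj_card_bij (@zip_index_inj a b n) _; rewrite !card_ord expnMn.
Qed.

Lemma bipartite_power_tens a b n (X : 'M[C]_a) (Y : 'M[C]_b) :
  bipartite_power n (X *t Y) = (ntensmx X n) *t (ntensmx Y n).
Proof.
case: n => [|n].
  apply/matrixP => p q.
  by rewrite [p](ord1 (p : 'I_1)) [q](ord1 (q : 'I_1)) !mxE mulr1.
elim: n => [|n IHn]; first by apply/matrixP => p q; rewrite mxE.
apply/matrixP => p q; rewrite mxE !ntensmxSS.
rewrite [LHS]tensmxE tensmxE.
have := congr1 (fun M : 'M_(_, _) => M
  (mxtens_index ((@mxtens_unindex a (a ^ n.+1) (mxtens_unindex p).1).2,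
                 (@mxtens_unindex b (b ^ n.+1) (mxtens_unindex p).2).2))
  (mxtens_index ((@mxtens_unindex a (a ^ n.+1) (mxtens_unindex q).1).2,
                 (@mxtens_unindex b (b ^ n.+1) (mxtens_unindex q).2).2))) IHn.
rewrite mxE tensmxE => ->.
rewrite [RHS]mxE [X in _ = X * _]mxE [X in _ = _ * X]mxE.
by rewrite mulrACA.
Qed.

Lemma psdmx_gram m n (Y : 'M[C]_(m, n)) : psdmx (Y^t* *m Y).
Proof.
split.
  apply/is_hermitianmxP; rewrite expr0 scale1r.
  by rewrite trmx_mul map_mxM trmxCK.
move=> v; rewrite mulmxA -mulmxA.
have -> : v^t* *m Y^t* = (Y *m v)^t* by rewrite trmx_mul map_mxM.
rewrite mxE sumr_ge0 // => i _.
by rewrite !mxE mulrC mul_conjC_ge0.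
Qed.

Lemma psdmxP n (X : 'M[C]_n) : psdmx X -> exists Y : 'M[C]_n, X = Y^t* *m Y.
Proof.
move=> [hX pX]; pose P := spectralmx X; pose d := spectral_diag X.
have uP : P \is unitarymx := spectral_unitarymx X.
have XE : X = P^t* *m diag_mx d *m P.
  rewrite -(invmx_unitary uP).
  exact/orthomx_spectralP/hermitian_normalmx.
have d_ge0 i : 0 <= d 0 i.
  have := pX (P^t* *m delta_mx i 0).
  rewrite {1}XE trmx_mul map_mxM trmxCK -!mulmxA [P *m (P^t* *m _)]mulmxA.
  rewrite (unitarymxP uP) mul1mx [P *m (P^t* *m _)]mulmxA (unitarymxP uP) mul1mx.
  rewrite mul_diag_mx mxE (bigD1 i) //= big1 => [|j ji].
    by rewrite addr0 !mxE !eqxx mulr1 conjC1 mul1r.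
  by rewrite !mxE (negbTE ji) conjC0 mul0r.
pose s : 'rV[C]_n := \row_i sqrtC (d 0 i).
exists (diag_mx s *m P); rewrite trmx_mul map_mxM {1}XE -!mulmxA; congr (_ *m _).
rewrite [RHS]mulmxA; congr (_ *m _); apply/matrixP => i j.
rewrite tr_diag_mx map_diag_mx mul_diag_mx !mxE.
case: eqP => [_|_]; last by rewrite !mulr0n mulr0.
have sC : (sqrtC (d 0 i))^* = sqrtC (d 0 i) by rewrite geC0_conj ?sqrtC_ge0.
by rewrite !mulr1n [X in _ = X * _]sC -expr2 sqrtCK.
Qed.

Lemma psdmx_tens m n (X : 'M[C]_m) (Y : 'M[C]_n) :
  psdmx X -> psdmx Y -> psdmx (X *t Y).
Proof.
move=> /psdmxP[X' ->] /psdmxP[Y' ->].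
by rewrite -tensmx_mul -map_mxT -trmx_tens; apply: psdmx_gram.
Qed.

Lemma psdmx_ntens n k (X : 'M[C]_n) : psdmx X -> psdmx (ntensmx X k).
Proof.
move=> pX; case: k => [|k].
  have := psdmx_gram (1%:M : 'M[C]_(n ^ 0)).
  by rewrite trmx1 map_mx1 mulmx1.
by elim: k => [|k IHk] //; apply: psdmx_tens.
Qed.

Lemma mxtrace_tens m n (X : 'M[C]_m) (Y : 'M[C]_n) :
  \tr (X *t Y) = \tr X * \tr Y.
Proof. by rewrite /mxtrace mulr_sum; apply: eq_bigr => i _; rewrite mxE. Qed.

Lemma mxtrace_ntens n k (X : 'M[C]_n) : \tr (ntensmx X k) = \tr X ^+ k.
Proof.
case: k => [|k]; first by rewrite ntensmx0 expr0 mxtrace1.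
elim: k => [|k IHk]; first by rewrite expr1.
by rewrite ntensmxSS mxtrace_tens IHk -exprS.
Qed.

Lemma psdmx_mxsub m n (f : 'I_m -> 'I_n) (X : 'M[C]_n) :
  psdmx X -> psdmx (mxsub f f X).
Proof.
move=> /psdmxP[Y ->].
rewrite (_ : mxsub f f _ = (colsub f Y)^t* *m colsub f Y); first exact: psdmx_gram.
by apply/matrixP => i j; rewrite !mxE; apply: eq_bigr => k _; rewrite !mxE.
Qed.

Lemma bipartite_power_psd a b n (rho : density C (a * b)) :
  psdmx (bipartite_power n rho).
Proof. exact/psdmx_mxsub/psdmx_ntens/density_psd. Qed.

Lemma bipartite_power_tr a b n (rho : density C (a * b)) :
  \tr (bipartite_power n rho) = 1.
Proof.
rewrite -[RHS](expr1n _ n) -(density_tr rho) -mxtrace_ntens /mxtrace.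
rewrite [RHS](reindex (@zip_index a b n)) /=; last first.
  exact/onW_bij/zip_index_bij.
by apply: eq_bigr => i _; rewrite mxE.
Qed.

Definition density_power a b n (rho : density C (a * b)) :
    density C (a ^ n * b ^ n) :=
  Density (bipartite_power_psd n rho) (bipartite_power_tr n rho).

End TensorPowers.

(* Main.v *)
(* The witness is the conditional min-entropy
   [max (0, - ln (min {c | rho_AB <= c I_A (x) rho_B}))].  A conditionally mixing
   channel maps [I_A (x) rho_B] to [I_A (x) sigma_B'], where sigma_B' is the
   marginal of its output on rho_AB: composing with the channel that replaces A
   by the uniform state does not change that marginal.  So the operator
   inequality survives by complete positivity.  Weak additivity of the logarithm
   survives truncation at 0 because the power n is nonnegative. *)
From HB Require Import structures.
Require Import Defs.
From mathcomp Require Import all_boot all_order all_algebra.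
From mathcomp Require Import classical_sets sequences exp.

Set Implicit Arguments.
Unset Strict Implicit.
Unset Printing Implicit Defensive.

Import Order.TTheory GRing.Theory Num.Theory.
Local Open Scope ring_scope.
Local Open Scope sesquilinear_scope.

(** * Algebra of Kronecker products and tensor powers *)

Lemma sum_mxtens_index (V : nmodType) m n (F : 'I_(m * n) -> V) :
  \sum_k F k = \sum_(i < m) \sum_(j < n) F (mxtens_index (i, j)).
Proof.
rewrite pair_bigA /=; apply: reindex.
exists (@mxtens_unindex m n) => k _; last exact: mxtens_unindexK.
by rewrite mxtens_indexK; case: k.
Qed.

Lemma tensmxBl (R : pzRingType) m n p q (X Y : 'M[R]_(m, n)) (Z : 'M_(p, q)) :
  (X - Y) *t Z = X *t Z - Y *t Z.
Proof. by apply/matrixP => i j; rewrite !mxE mulrBl. Qed.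

Lemma tensmxBr (R : pzRingType) m n p q (X Y : 'M[R]_(m, n)) (Z : 'M_(p, q)) :
  Z *t (X - Y) = Z *t X - Z *t Y.
Proof. by apply/matrixP => i j; rewrite !mxE mulrBr. Qed.

Lemma tensmxZl (R : pzRingType) m n p q c (X : 'M[R]_(m, n)) (Z : 'M_(p, q)) :
  (c *: X) *t Z = c *: (X *t Z).
Proof. by apply/matrixP => i j; rewrite !mxE mulrA. Qed.

Lemma tensmxZr (R : comPzRingType) m n p q c (X : 'M[R]_(m, n))
    (Z : 'M_(p, q)) :
  X *t (c *: Z) = c *: (X *t Z).
Proof. by apply/matrixP => i j; rewrite !mxE mulrCA. Qed.

Lemma tensmx11 (R : pzRingType) m n :
  (1%:M : 'M[R]_m) *t (1%:M : 'M_n) = 1%:M.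
Proof.
apply/matrixP => k l; case: (mxtens_indexP k) => i j.
case: (mxtens_indexP l) => i' j'; rewrite tensmxE !mxE.
by rewrite (can_eq (@mxtens_indexK _ _)) xpair_eqE -natrM mulnb.
Qed.

Lemma ntensmx_1 (R : pzRingType) m n :
  ntensmx (1%:M : 'M[R]_m) n = 1%:M.
Proof.
by case: n => // n; elim: n => // n IHn; rewrite ntensmxSS IHn tensmx11.
Qed.

Lemma ntensmxZ (R : comPzRingType) m p n c (X : 'M[R]_(m, p)) :
  ntensmx (c *: X) n = c ^+ n *: ntensmx X n.
Proof.
case: n => [|n]; first by rewrite expr0 scale1r.
elim: n => // n IHn.
by rewrite !ntensmxSS IHn tensmxZl tensmxZr scalerA -exprS.
Qed.

(** * The cone of positive semidefinite matrices *)

Section PositiveSemidefinite.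
Variable C : numClosedFieldType.

Lemma trmxC_tens m n p q (X : 'M[C]_(m, n)) (Y : 'M_(p, q)) :
  (X *t Y)^t* = X^t* *t Y^t*.
Proof. by rewrite trmx_tens map_mxT. Qed.

Lemma trmxC_mul m n p (X : 'M[C]_(m, n)) (Y : 'M_(n, p)) :
  (X *m Y)^t* = Y^t* *m X^t*.
Proof. by rewrite trmx_mul map_mxM. Qed.

Lemma trmxC1 n : (1%:M : 'M[C]_n)^t* = 1%:M.
Proof. by rewrite trmx1 map_mx1. Qed.

Lemma psdmx_herm n (X : 'M[C]_n) : psdmx X -> X^t* = X.
Proof. by case=> /is_hermitianmxP hX _; rewrite expr0 scale1r in hX. Qed.

Lemma psdmxI n (X : 'M[C]_n) :
  X^t* = X -> (forall v : 'cV_n, 0 <= (v^t* *m X *m v) 0 0) -> psdmx X.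
Proof.
by move=> hX pX; split=> //; apply/is_hermitianmxP; rewrite expr0 scale1r hX.
Qed.

Lemma psdmx0 n : psdmx (0 : 'M[C]_n).
Proof.
apply: psdmxI => [|v]; first by rewrite trmx0 map_mx0.
by rewrite mulmx0 mul0mx mxE.
Qed.

Lemma psdmxD n (X Y : 'M[C]_n) : psdmx X -> psdmx Y -> psdmx (X + Y).
Proof.
move=> pX pY; apply: psdmxI => [|v].
  by rewrite linearD map_mxD /= !psdmx_herm.
by rewrite mulmxDr mulmxDl mxE addr_ge0 // ?(proj2 pX) ?(proj2 pY).
Qed.

Lemma psdmxZ n c (X : 'M[C]_n) : 0 <= c -> psdmx X -> psdmx (c *: X).
Proof.
move=> c0 pX; apply: psdmxI => [|v].
  by rewrite linearZ map_mxZ /= geC0_conj ?psdmx_herm.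
by rewrite -scalemxAr -scalemxAl mxE mulr_ge0 ?(proj2 pX).
Qed.

Lemma psdmx_conj m n (W : 'M[C]_(m, n)) (X : 'M_n) :
  psdmx X -> psdmx (W *m X *m W^t*).
Proof.
move=> /psdmxP[Y ->].
have -> : W *m (Y^t* *m Y) *m W^t* = (Y *m W^t*)^t* *m (Y *m W^t*).
  by rewrite trmxC_mul trmxCK !mulmxA.
exact: psdmx_gram.
Qed.

Lemma psdmx_tr_ge0 n (X : 'M[C]_n) : psdmx X -> 0 <= \tr X.
Proof.
move=> [_ pX]; apply: sumr_ge0 => i _.
(* Testing positivity at a basis vector extracts a diagonal entry. *)
have := pX (delta_mx i 0); rewrite -mulmxA -colE.
suff -> : (delta_mx i 0 : 'cV[C]_n)^t* = delta_mx 0 i.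
  by rewrite -rowE !mxE.
by apply/matrixP => j k; rewrite !mxE conjC_nat andbC.
Qed.

Lemma psdmx1 n : psdmx (1%:M : 'M[C]_n).
Proof. by have := psdmx_gram (1%:M : 'M[C]_n); rewrite trmxC1 mulmx1. Qed.

(** * Partial trace, maps acting on one factor, and channels *)

Lemma psdmx_ptrace_l a b (X : 'M[C]_(a * b)) :
  psdmx X -> psdmx (ptrace_l X).
Proof.
(* The partial trace is a sum of principal submatrices, one for each basis index of the left
   factor. *)
move=> pX; have -> : ptrace_l X =
    \sum_i mxsub (fun j => mxtens_index (i, j)) (fun j => mxtens_index (i, j)) X.
  by apply/matrixP => j l; rewrite mxE summxE; apply: eq_bigr => i _; rewrite mxE.
by apply: (big_ind (@psdmx C b)) => [|? ?|i _];
  [exact: psdmx0 | exact: psdmxD | exact: psdmx_mxsub].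
Qed.

Lemma mxtrace_ptrace_l a b (X : 'M[C]_(a * b)) : \tr (ptrace_l X) = \tr X.
Proof.
rewrite /mxtrace sum_mxtens_index exchange_big /=.
by apply: eq_bigr => j _; rewrite mxE.
Qed.

Lemma ptrace_l_tens a b (X : 'M[C]_a) (Y : 'M_b) :
  ptrace_l (X *t Y) = \tr X *: Y.
Proof.
apply/matrixP => j l; rewrite !mxE mulr_suml; apply: eq_bigr => i _.
exact: tensmxE.
Qed.

(** Each entry of the partial trace is the trace of the block on which [F] acts, and [F] preserves
    that trace. *)
Lemma ptrace_l_tens_id a a' b (F : {linear 'M[C]_a -> 'M[C]_a'})
    (X : 'M_(a * b)) :
  trace_preserving F -> ptrace_l (tens_id F X) = ptrace_l X.
Proof.
move=> tF; apply/matrixP => j l; rewrite !mxE.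
transitivity (\tr (F (\matrix_(s, t) X (mxtens_index (s, j))
                                       (mxtens_index (t, l))))).
  by apply: eq_bigr => i _; rewrite mxE !mxtens_indexK.
by rewrite tF; apply: eq_bigr => i _; rewrite mxE.
Qed.

(** A map with single Kraus operator [W] extends to one with Kraus operator [W *t 1%:M]. In each
    double sum the identity factor leaves only the term with matching right index. *)
Lemma tens_id_conj m n k (F : 'M[C]_m -> 'M[C]_n) (W : 'M_(n, m))
    (X : 'M_(m * k)) :
  (forall Y, F Y = W *m Y *m W^t*) ->
  tens_id F X = (W *t 1%:M) *m X *m (W *t 1%:M)^t*.
Proof.
move=> FE; apply/matrixP => p q; case: (mxtens_indexP p) => i r.
case: (mxtens_indexP q) => j s; rewrite !mxE !mxtens_indexK FE !mxE.
rewrite sum_mxtens_index; apply: eq_bigr => l _.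
rewrite (bigD1 s) //= big1 => [|s' s's]; last first.
  by rewrite !mxE !mxtens_indexK /= eq_sym (negbTE s's) mulr0 conjC0 mulr0.
rewrite !mxE !mxtens_indexK /= eqxx mulr1 addr0; congr (_ * _).
rewrite sum_mxtens_index; apply: eq_bigr => l' _.
rewrite (bigD1 r) //= big1 => [|r' r'r]; last first.
  by rewrite !mxE !mxtens_indexK /= eq_sym (negbTE r'r) mulr0 mul0r.
by rewrite !mxE !mxtens_indexK /= eqxx mulr1 addr0.
Qed.

Lemma completely_positive_psdmx m n (F : {linear 'M[C]_m -> 'M[C]_n})
    (X : 'M_m) :
  completely_positive F -> psdmx X -> psdmx (F X).
Proof.
(* A one-dimensional ancilla suffices: [X *t 1%:M] is [X] up to reindexing. *)
move=> cpF pX; have := cpF 1%N (X *t 1%:M) (psdmx_tens pX (psdmx1 1)).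
rewrite tens_id_tens => /(psdmx_mxsub (fun i => mxtens_index (i, 0))).
suff -> : mxsub (fun i => mxtens_index (i, 0)) (fun i => mxtens_index (i, 0))
  (F X *t (1%:M : 'M_1)) = F X by [].
by apply/matrixP => i j; rewrite mxE tensmxE mxE mulr1.
Qed.

Lemma isometric_channel_tp m n (F : {linear 'M[C]_m -> 'M[C]_n}) :
  isometric_channel F -> trace_preserving F.
Proof. by case=> W [WW FE] X; rewrite FE mxtrace_mulC mulmxA WW mul1mx. Qed.

Lemma psdmx_uniform a : psdmx (uniform_mx C a).
Proof.
by rewrite /uniform_mx -scalemx1; apply/psdmxZ/psdmx1; rewrite invr_ge0 ler0n.
Qed.

Lemma mxtrace_uniform a : (0 < a)%N -> \tr (uniform_mx C a) = 1.
Proof.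
by move=> a0; rewrite mxtrace_scalar -[LHS]mulr_natr mulVf // pnatr_eq0 -lt0n.
Qed.

(** The channel that discards a system and prepares the uniform state; semi-causality is applied to
    it. *)
Definition replacement a (X : 'M[C]_a) : 'M[C]_a := \tr X *: uniform_mx C a.

Lemma replacement_is_linear a : linear (@replacement a).
Proof.
by move=> c X Y; rewrite /replacement linearP scalerDl scalerA.
Qed.

HB.instance Definition _ a := GRing.isLinear.Build C 'M[C]_a 'M[C]_a *:%R
  (@replacement a) (@replacement_is_linear a).

Lemma tens_id_replacement a b (X : 'M[C]_(a * b)) :
  tens_id (@replacement a) X = uniform_mx C a *t ptrace_l X.
Proof.
apply/matrixP => p q; case: (mxtens_indexP p) => i r.
case: (mxtens_indexP q) => j s.
rewrite tensmxE mxE !mxtens_indexK /= [LHS]mxE mulrC [ptrace_l _ _ _]mxE.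
by congr (_ * _); apply: eq_bigr => l _; rewrite mxE.
Qed.

Lemma replacement_channel a : (0 < a)%N -> channel (@replacement a).
Proof.
move=> a0; split=> [k X pX|X]; last by rewrite mxtraceZ mxtrace_uniform ?mulr1.
rewrite tens_id_replacement; apply: psdmx_tens; first exact: psdmx_uniform.
exact: psdmx_ptrace_l.
Qed.

Definition density_ptrace_l a b (rho : density C (a * b)) : density C b :=
  Density (psdmx_ptrace_l (density_psd rho))
    (etrans (mxtrace_ptrace_l rho) (density_tr rho)).

Lemma density_gt0 n : density C n -> (0 < n)%N.
Proof.
case: n => // rho; have := density_tr rho; rewrite /mxtrace big_ord0.
by move/eqP; rewrite eq_sym oner_eq0.
Qed.

End PositiveSemidefinite.

(** * The operator inequality behind the entropy, and its behaviour under majorization *)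

Section OperatorInequality.
Variable C : numClosedFieldType.

(** Its positivity is the inequality [X <= c I_A (x) X_B], where [X_B] is the marginal of [X]. *)
Definition slack a b (c : C) (X : 'M[C]_(a * b)) : 'M[C]_(a * b) :=
  c *: (1%:M *t ptrace_l X) - X.

Lemma mxtrace_slack a b c (X : 'M[C]_(a * b)) :
  \tr (slack c X) = (c * a%:R - 1) * \tr X.
Proof.
by rewrite linearB /= mxtraceZ mxtrace_tens mxtrace1 mxtrace_ptrace_l mulrBl
  mul1r mulrA.
Qed.

Lemma psdmx_slack_isometry a a' b c (F : {linear 'M[C]_a -> 'M[C]_a'})
    (X : 'M[C]_(a * b)) :
  0 <= c -> isometric_channel F -> psdmx X ->
  psdmx (slack c X) -> psdmx (slack c (tens_id F X)).
Proof.
move=> c0 iF pX pS; rewrite /slack ptrace_l_tens_id; last first.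
  exact: isometric_channel_tp.
case: iF => W [WW FE]; rewrite (tens_id_conj _ FE).
set W1 := W *t 1%:M.
have -> : c *: (1%:M *t ptrace_l X) - W1 *m X *m W1^t* =
  c *: ((1%:M - W *m W^t*) *t ptrace_l X) + W1 *m slack c X *m W1^t*.
  have -> : W1 *m slack c X *m W1^t* =
      c *: ((W *m W^t*) *t ptrace_l X) - W1 *m X *m W1^t*.
    rewrite mulmxBr mulmxBl -scalemxAr -scalemxAl {1 2}/W1.
    by rewrite trmxC_tens trmxC1 !tensmx_mul mul1mx !mulmx1.
  by rewrite tensmxBl scalerBr addrA subrK.
apply: psdmxD; last exact: psdmx_conj.
apply: psdmxZ c0 _; apply: psdmx_tens (psdmx_ptrace_l pX).
(* [I - W W^*] is an orthogonal projection, hence its own Gram matrix and positive. *)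
have PP : (1%:M - W *m W^t*)^t* = 1%:M - W *m W^t*.
  by rewrite linearB map_mxB /= trmxC1 trmxC_mul trmxCK.
have := psdmx_gram (1%:M - W *m W^t*).
rewrite PP mulmxBl mul1mx mulmxBr mulmx1 -mulmxA [W^t* *m _]mulmxA WW mul1mx.
by rewrite subrr subr0.
Qed.

(** Conjugation by [W^* (x) I] undoes the isometry, since [W^* W = I]. *)
Lemma psdmx_slack_isometryV a a' b c (F : {linear 'M[C]_a -> 'M[C]_a'})
    (X : 'M[C]_(a * b)) :
  isometric_channel F -> psdmx (slack c (tens_id F X)) -> psdmx (slack c X).
Proof.
move=> iF; rewrite /slack ptrace_l_tens_id; last exact: isometric_channel_tp.
case: iF => W [WW FE]; rewrite (tens_id_conj _ FE).
move=> /(psdmx_conj (W^t* *t 1%:M)); rewrite !trmxC_tens trmxCK !trmxC1.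
rewrite mulmxBr mulmxBl -scalemxAr -scalemxAl !tensmx_mul !mulmx1 mul1mx WW.
rewrite -!mulmxA tensmx_mul WW mulmx1 tensmx11 mulmx1.
by rewrite mulmxA tensmx_mul WW mulmx1 tensmx11 mul1mx.
Qed.

Lemma ptrace_l_conditionally_mixing a b b'
    (N : {linear 'M[C]_(a * b) -> 'M[C]_(a * b')}) (rho : density C (a * b)) :
  conditionally_mixing N ->
  N (uniform_mx C a *t ptrace_l rho) = uniform_mx C a *t ptrace_l (N rho).
Proof.
move=> [_ cuN scN].
have a0 : (0 < a)%N by have := density_gt0 rho; rewrite muln_gt0 => /andP[].
have [tau Ntau] := cuN (density_ptrace_l rho).
(* Conditional unitality only provides some [tau]; semi-causality, applied to the replacement
   channel, identifies it with the marginal of [N rho]. *)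
rewrite -(scN _ (replacement_channel C a0)) tens_id_replacement [N _]Ntau.
by rewrite ptrace_l_tens mxtrace_uniform // scale1r.
Qed.

(** Writing [I_A] as [a] times the uniform state shows that [N] carries the slack of [rho] to the
    slack of [N rho]. *)
Lemma psdmx_slack_conditionally_mixing a b b' c
    (N : {linear 'M[C]_(a * b) -> 'M[C]_(a * b')}) (rho : density C (a * b)) :
  conditionally_mixing N -> psdmx (slack c rho) -> psdmx (slack c (N rho)).
Proof.
move=> mN pS; have [[cpN _] _ _] := mN.
have a0 : (0 < a)%N by have := density_gt0 rho; rewrite muln_gt0 => /andP[].
have uE : 1%:M = a%:R *: uniform_mx C a.
  by rewrite /uniform_mx scale_scalar_mx mulfV // pnatr_eq0 -lt0n.
have -> : slack c (N rho) = N (slack c rho).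
  rewrite /slack uE !tensmxZl linearB ![N (_ *: _)]linearZ /=.
  by rewrite ptrace_l_conditionally_mixing.
exact: completely_positive_psdmx.
Qed.

Lemma tens_id_density_tr m n k (F : {linear 'M[C]_m -> 'M[C]_n})
    (rho : density C (m * k)) :
  isometric_channel F -> \tr (tens_id F rho) = 1.
Proof.
move=> iF; rewrite -mxtrace_ptrace_l ptrace_l_tens_id.
  by rewrite mxtrace_ptrace_l density_tr.
exact: isometric_channel_tp.
Qed.

Lemma tens_id_density_psd m n k (F : {linear 'M[C]_m -> 'M[C]_n})
    (rho : density C (m * k)) :
  isometric_channel F -> psdmx (tens_id F rho).
Proof.
by case=> W [_ FE]; rewrite (tens_id_conj _ FE); apply/psdmx_conj/density_psd.
Qed.

(** The inequality is carried forward along [V] and [N], then pulled back along [U]. *)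
Lemma psdmx_slack_cond_majorizes a b a' b' c
    (rho : density C (a * b)) (sigma : density C (a' * b')) :
  0 <= c -> cond_majorizes a b a' b' rho sigma ->
  psdmx (slack c rho) -> psdmx (slack c sigma).
Proof.
move=> c0 [a'' [V [U [N [_ iV iU mN UE]]]]] pS.
apply: (psdmx_slack_isometryV iU); rewrite UE.
(* Conditional unitality speaks of states only, so the embedded operator is packaged as a
   density. *)
pose rhoV := Density (tens_id_density_psd rho iV) (tens_id_density_tr rho iV).
apply: (psdmx_slack_conditionally_mixing (rho := rhoV) mN) => /=.
exact/psdmx_slack_isometry/pS/density_psd.
Qed.

(** * Tensor powers of the operator inequality *)

Lemma zip_indexSSE a b n x1 y1 (x2 : 'I_(a ^ n.+1)) (y2 : 'I_(b ^ n.+1)) :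
  @zip_index a b n.+2
    (mxtens_index (mxtens_index (x1, x2), mxtens_index (y1, y2))) =
  mxtens_index (mxtens_index (x1, y1),
                @zip_index a b n.+1 (mxtens_index (x2, y2))).
Proof.
set p := mxtens_index (mxtens_index (x1, x2), _).
pose x := @mxtens_unindex a (a ^ n.+1) (mxtens_unindex p).1.
pose y := @mxtens_unindex b (b ^ n.+1) (mxtens_unindex p).2.
rewrite -[LHS]/(@mxtens_index (a * b) ((a * b) ^ n.+1)
  (mxtens_index (x.1, y.1), @zip_index a b n.+1 (mxtens_index (x.2, y.2)))).
by rewrite /x /y /p !mxtens_indexK.
Qed.

Lemma bipartite_powerSSE a b n (X : 'M[C]_(a * b)) x1 x1' y1 y1'
    (x2 x2' : 'I_(a ^ n.+1)) (y2 y2' : 'I_(b ^ n.+1)) :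
  bipartite_power n.+2 X
    (mxtens_index (mxtens_index (x1, x2), mxtens_index (y1, y2)))
    (mxtens_index (mxtens_index (x1', x2'), mxtens_index (y1', y2'))) =
  X (mxtens_index (x1, y1)) (mxtens_index (x1', y1')) *
  bipartite_power n.+1 X (mxtens_index (x2, y2)) (mxtens_index (x2', y2')).
Proof.
by rewrite mxE ntensmxSS !zip_indexSSE tensmxE [in RHS]mxE.
Qed.

(** By induction: the sum over the basis of [A^n] splits into a sum for the first factor times a sum
    for the others. *)
Lemma ptrace_l_bipartite_power a b n (X : 'M[C]_(a * b)) :
  ptrace_l (bipartite_power n X) = ntensmx (ptrace_l X) n.
Proof.
case: n => [|n].
  apply/matrixP => i j; rewrite mxE big_ord1 mxE /ntensmx.
  by rewrite (ord1 (i : 'I_1)) (ord1 (j : 'I_1)) !mxE.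
elim: n => [|n IHn]; first by apply/matrixP => i j; rewrite !mxE;
  apply: eq_bigr => k _; rewrite mxE.
apply/matrixP => p q; case: (@mxtens_indexP b (b ^ n.+1) p) => y1 y2.
case: (@mxtens_indexP b (b ^ n.+1) q) => y1' y2'.
rewrite ntensmxSS -IHn [RHS]tensmxE !mxE (@sum_mxtens_index _ a (a ^ n.+1)).
rewrite mulr_suml; apply: eq_bigr => i _; rewrite mulr_sumr.
by apply: eq_bigr => j _; rewrite bipartite_powerSSE.
Qed.

(** Reduces the slack of a power, up to reordering the factors, to a difference of two tensor
    powers. *)
Lemma slack_bipartite_power a b n c (X : 'M[C]_(a * b)) :
  slack (c ^+ n) (bipartite_power n X) =
  mxsub (@zip_index a b n) (@zip_index a b n)
    (ntensmx (c *: (1%:M *t ptrace_l X)) n - ntensmx X n).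
Proof.
rewrite /slack ptrace_l_bipartite_power -[in LHS](ntensmx_1 C a n).
rewrite -bipartite_power_tens /bipartite_power ntensmxZ.
by apply/matrixP => i j; rewrite !mxE.
Qed.

(** Telescoping: with [Y'] and [X'] the lower powers, [Y (x) Y' - X (x) X' = (Y - X) (x) Y' + X (x)
    (Y' - X')], and both terms are positive. *)
Lemma psdmx_ntensB n k (X Y : 'M[C]_n) :
  psdmx X -> psdmx (Y - X) -> psdmx (ntensmx Y k - ntensmx X k).
Proof.
move=> pX pYX; have pY : psdmx Y by rewrite -[Y](subrK X); apply: psdmxD.
case: k => [|k]; first by rewrite !ntensmx0 subrr; apply: psdmx0.
elim: k => // k IHk; rewrite !ntensmxSS.
rewrite -[_ - _](subrKA (X *t ntensmx Y k.+1)) -tensmxBl -tensmxBr.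
by apply: psdmxD; apply: psdmx_tens => //; exact: (@psdmx_ntens C n k.+1).
Qed.

Lemma psdmx_slack_power a b n c (X : 'M[C]_(a * b)) :
  psdmx X -> psdmx (slack c X) ->
  psdmx (slack (c ^+ n) (bipartite_power n X)).
Proof.
move=> pX pS; rewrite slack_bipartite_power.
exact/psdmx_mxsub/psdmx_ntensB.
Qed.

Lemma quadratic_formB n (X Y : 'M[C]_n) (v : 'cV_n) :
  (v^t* *m (X - Y) *m v) 0 0 = (v^t* *m X *m v) 0 0 - (v^t* *m Y *m v) 0 0.
Proof. by rewrite mulmxBr mulmxBl mxE [X in _ + X]mxE. Qed.

Lemma ntensmx_quadratic_form n k (v : 'cV[C]_n) :
  exists w : 'cV[C]_(n ^ k), forall X : 'M_n,
    (w^t* *m ntensmx X k *m w) 0 0 = ((v^t* *m X *m v) 0 0) ^+ k.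
Proof.
case: k => [|k].
  exists (1%:M : 'M_1) => X.
  by rewrite ntensmx0 expr0 mulmx1 trmxC1 mul1mx mxE.
elim: k => [|k [w wE]]; first by exists v.
(* The witness is the tensor power of [v]. Its [1 * 1] columns compute to [1]; the last line matches
   [mxtens_index (0, 0)] with [0]. *)
exists (v *t w : 'M_(n * n ^ k.+1, 1 * 1)) => X.
have e : (v *t w)^t* *m (X *t ntensmx X k.+1) *m (v *t w) =
    (v^t* *m X *m v) *t (w^t* *m ntensmx X k.+1 *m w).
  by rewrite trmxC_tens !tensmx_mul.
have := congr1 (fun M : 'M_(1 * 1) =>
  M (mxtens_index (0, 0)) (mxtens_index (0, 0))) e.
rewrite tensmxE wE -exprS => <-.
by congr (fun_of_matrix _ _ _); apply: val_inj.
Qed.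

(* A vector violating the inequality for X has a tensor power violating it for
   the power of X. *)
Lemma psdmx_slack_powerV a b n c (X : 'M[C]_(a * b)) :
  0 <= c -> psdmx X -> psdmx (slack (c ^+ n.+1) (bipartite_power n.+1 X)) ->
  psdmx (slack c X).
Proof.
move=> c0 pX; rewrite slack_bipartite_power.
set Y := c *: (_ *t _).
(* Reindexing by the inverse [u] undoes the reordering of the factors. *)
have [u zu uz] := zip_index_bij a b n.+1.
move=> /(psdmx_mxsub u) pS.
have pY : psdmx Y.
  by apply: psdmxZ c0 _; apply: psdmx_tens; [exact: psdmx1 | exact: psdmx_ptrace_l].
rewrite /slack -/Y; apply: psdmxI => [|v].
  by rewrite linearB map_mxB /= (psdmx_herm pX) (psdmx_herm pY).
rewrite quadratic_formB subr_ge0.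
have [w wE] := ntensmx_quadratic_form n.+1 v.
(* Both quadratic forms are nonnegative, so they may be compared through their powers, which are the
   quadratic forms of the tensor powers at [w]. *)
rewrite -(ler_pXn2r (ltn0Sn n)) ?qualifE /= ?(proj2 pX) ?(proj2 pY) //.
rewrite -!wE -subr_ge0.
have := proj2 pS w; congr (_ <= _).
rewrite (_ : mxsub u u _ = ntensmx Y n.+1 - ntensmx X n.+1).
  by rewrite quadratic_formB.
by apply/matrixP => i j; rewrite mxE mxE !uz.
Qed.

End OperatorInequality.

(** * The truncated conditional min-entropy and its properties *)

Section ConditionalMinEntropy.
Variable R : realType.
Local Open Scope classical_set_scope.
Local Open Scope complex_scope.

(* The disjunct [t = 0] implements the truncation at 0. *)
Definition entropy_bounds a b (rho : density R[i] (a * b)) : set R :=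
  [set t | 0 <= t /\ (t = 0 \/ psdmx (slack (expR (- t))%:C rho))].

Definition min_entropy a b (rho : density R[i] (a * b)) : R :=
  sup (entropy_bounds rho).

Lemma entropy_bounds0 a b (rho : density R[i] (a * b)) : entropy_bounds rho 0.
Proof. by split; last left. Qed.

(** A positive slack has nonnegative trace [expR (- t) * a - 1]. This upper bound makes the supremum
    in [min_entropy] a genuine one. *)
Lemma entropy_bounds_le_ln a b (rho : density R[i] (a * b)) :
  ubound (entropy_bounds rho) (ln a%:R).
Proof.
have a0 : (0 < a)%N by have := density_gt0 rho; rewrite muln_gt0 => /andP[].
move=> t [_ [->|/psdmx_tr_ge0]]; first by rewrite ln_ge0 // ler1n.
rewrite mxtrace_slack density_tr mulr1 subr_ge0 -(rmorph_nat (real_complex R)).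
rewrite -rmorphM -(rmorph1 (real_complex R)) lecR expRN mulrC.
rewrite ler_pdivlMr ?expR_gt0 // mul1r => le_a.
by rewrite -(expRK t) ler_ln ?posrE ?expR_gt0 ?ltr0n.
Qed.

Lemma min_entropy_ub a b (rho : density R[i] (a * b)) t :
  entropy_bounds rho t -> t <= min_entropy rho.
Proof. by apply/ub_le_sup; exists (ln a%:R); exact: entropy_bounds_le_ln. Qed.

Lemma min_entropy_le a b (rho : density R[i] (a * b)) x :
  (forall t, entropy_bounds rho t -> t <= x) -> min_entropy rho <= x.
Proof. by apply: ge_sup; exists 0; exact: entropy_bounds0. Qed.

Lemma min_entropy_ge0 a b (rho : density R[i] (a * b)) : 0 <= min_entropy rho.
Proof. exact/min_entropy_ub/entropy_bounds0. Qed.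

Lemma min_entropy_monotone a b a' b'
    (rho : density R[i] (a * b)) (sigma : density R[i] (a' * b')) :
  cond_majorizes a b a' b' rho sigma -> min_entropy rho <= min_entropy sigma.
Proof.
move=> maj; apply: min_entropy_le => t [t0 pt]; apply: min_entropy_ub; split=> //.
case: pt => [|pt]; [by left | right].
by apply: psdmx_slack_cond_majorizes maj pt; rewrite ler0c expR_ge0.
Qed.

(** Multiplying [t] by [n.+1] raises the constant [expR (- t)] to the power [n.+1], and the
    truncation case [t = 0] is preserved. *)
Lemma entropy_bounds_power a b n (rho : density R[i] (a * b)) t :
  entropy_bounds (density_power n.+1 rho) (n.+1%:R * t) <->
  entropy_bounds rho t.
Proof.
have cE : (expR (- (n.+1%:R * t)))%:C = (expR (- t))%:C ^+ n.+1 :> R[i].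
  by rewrite -mulrN expRM_natl rmorphXn.
split=> -[t0 pt]; split.
- by rewrite pmulr_rge0 ?ltr0n in t0.
- case: pt => [/eqP|pt]; [rewrite mulf_eq0 pnatr_eq0 /= => /eqP; by left | right].
  rewrite cE in pt; apply: psdmx_slack_powerV pt; last exact: density_psd.
  by rewrite ler0c expR_ge0.
- by rewrite mulr_ge0.
- case: pt => [->|pt]; [by left; rewrite mulr0 | right].
  by rewrite cE; apply: psdmx_slack_power pt; exact: density_psd.
Qed.

Lemma min_entropy_power a b (rho : density R[i] (a * b)) n :
  min_entropy (density_power n rho) = n%:R * min_entropy rho.
Proof.
case: n => [|n].
  (* In the zeroth power the left system has dimension 1, so every bound is at most [ln 1 = 0]. *)
  apply/eqP; rewrite mul0r eq_le min_entropy_ge0 andbT.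
  by apply: min_entropy_le => t /entropy_bounds_le_ln; rewrite expn0 ln1.
have n0 : 0 < n.+1%:R :> R by rewrite ltr0n.
apply/eqP; rewrite eq_le; apply/andP; split.
  (* Every bound for the power is [n.+1] times a bound for [rho]. *)
  apply: min_entropy_le => t; have {1}-> : t = n.+1%:R * (t / n.+1%:R).
    by rewrite mulrC divfK ?gt_eqF.
  move=> /entropy_bounds_power/min_entropy_ub.
  by rewrite ler_pdivrMr // mulrC.
rewrite mulrC -ler_pdivlMr //; apply: min_entropy_le => t pt.
by rewrite ler_pdivlMr // mulrC; apply/min_entropy_ub/entropy_bounds_power.
Qed.

Definition uniform_density n (n0 : (0 < n)%N) : density R[i] n :=
  Density (psdmx_uniform R[i] n) (mxtrace_uniform R[i] n0).

(** With [B] one-dimensional, the slack of the uniform qubit state vanishes at [c = 1/2], so [ln 2]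
    is an admissible bound. *)
Lemma min_entropy_uniform_qubit_gt0 :
  0 < min_entropy (uniform_density (isT : (0 < 2 * 1)%N)).
Proof.
apply: (@lt_le_trans _ _ (ln 2)); first by rewrite ln_gt0 // ltr1n.
apply: min_entropy_ub; split; first by rewrite ln_ge0 // ler1n.
right; rewrite expRN lnK ?posrE ?ltr0n // rmorphV ?unitfE ?pnatr_eq0 //.
rewrite rmorph_nat /=.
have -> : slack 2%:R^-1 (uniform_mx R[i] (2 * 1)) = 0; last exact: psdmx0.
have e : uniform_mx R[i] (2 * 1) = uniform_mx R[i] 2 *t (1%:M : 'M_1).
  by rewrite /uniform_mx -[(_^-1)%:M in RHS]scalemx1 tensmxZl tensmx11 scalemx1.
rewrite /slack e ptrace_l_tens mxtrace_uniform // scale1r tensmx11 scalemx1.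
by rewrite -e /uniform_mx subrr.
Qed.

End ConditionalMinEntropy.

Theorem mainTheorem4 (R : realType) :
  exists g : forall a b : nat, density R[i] (a * b) -> R,
    (exists (a b : nat) (rho : density R[i] (a * b)), g a b rho <> 0) /\
    (forall (a b a' b' : nat)
            (rho : density R[i] (a * b)) (sigma : density R[i] (a' * b')),
       cond_majorizes a b a' b' rho sigma -> g a b rho <= g a' b' sigma) /\
    (forall (a b : nat) (rho : density R[i] (a * b)) (n : nat),
       g (a ^ n)%N (b ^ n)%N (density_power n rho) = n%:R * g a b rho) /\
    (forall (a b : nat) (rho : density R[i] (a * b)), 0 <= g a b rho).
Proof.
exists (@min_entropy R); split; last split; last split.
- exists 2%N, 1%N, (uniform_density R (isT : (0 < 2 * 1)%N)).
  exact/eqP/lt0r_neq0/min_entropy_uniform_qubit_gt0.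
- exact: min_entropy_monotone.
- by move=> a b rho n; apply: min_entropy_power.
- exact: min_entropy_ge0.
Qed.
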